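(* Let $\mathcal{S}=\langle\mathbf{Fm},\vdash\rangle$ be a logic over a language containing a unary connective $\neg$, and suppose there exist a formula $\alpha\in\mathit{Fm}$ with $\not\vdash\alpha$ and a variable $p\in V$ with $p\notin\mathrm{var}(\alpha)$. Then ECQ fails in the left variable inclusion companion $\mathcal{S}^l=\langle\mathbf{Fm},\vdash^l\rangle$ of $\mathcal{S}$; specifically $\{p,\neg p\}\not\vdash^l\alpha$.
   Context: $\mathbf{Fm}$ is the formula algebra of a logical language $\mathcal{L}$ (connectives of finite arity, including unary $\neg$) over a countably infinite set $V$ of variables, universe $\mathit{Fm}$. A logic is a pair $\langle\mathbf{Fm},\vdash\rangle$ with $\vdash\subseteq\mathcal{P}(\mathit{Fm})\times\mathit{Fm}$ reflexive, transitive (if $\Delta\vdash\psi$ for all $\psi\in\Sigma$ and $\Sigma\vdash\varphi$ then $\Delta\vdash\varphi$) and closed under substitutions. $\mathrm{var}(\varphi)$ is the set of variables of $\varphi$, $\mathrm{var}(\Gamma)=\bigcup_{\gamma\in\Gamma}\mathrm{var}(\gamma)$. Left variable inclusion companion: $\Gamma\vdash^l\varphi$ iff there is $\Gamma'\subseteq\Gamma$ with $\mathrm{var}(\Gamma')\subseteq\mathrm{var}(\varphi)$ and $\Gamma'\vdash\varphi$. ECQ holds in a logic $\langle\mathbf{Fm},\vdash'\rangle$ if $\{\alpha,\neg\alpha\}\vdash'\beta$ for all formulas $\alpha,\beta$; ECQ fails if this is not the case. *)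

(* Defs.v *)
From mathcomp Require Import all_boot.
From mathcomp Require Import boolp classical_sets functions cardinality.

Set Implicit Arguments.
Unset Strict Implicit.
Unset Printing Implicit Defensive.

Local Open Scope classical_set_scope.

Record language := Language { conn :> Type; arity : conn -> nat }.

Record unary (L : language) := Unary {
  unary_conn :> conn L;
  unary_arity : arity unary_conn = 1%N
}.

Inductive Fm (L : language) (V : Type) : Type :=
| Var of V
| App (c : conn L) of {ffun 'I_(arity c) -> Fm L V}.

Arguments Var {L V} _.
Arguments App {L V} c _.

Section Formulas.
Variables (L : language) (V : Type).
Implicit Types (phi : Fm L V) (G : set (Fm L V)).

(* The argument tuple is the constant one, of length 1 by [unary_arity]. *)
Definition App1 (c : unary L) phi : Fm L V := App c [ffun => phi].

(* The endomorphism of the formula algebra that extends [s]; as the algebra is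
   absolutely free over [V], every endomorphism is of this form. *)
Fixpoint subst (s : V -> Fm L V) phi : Fm L V :=
  match phi with
  | Var x => s x
  | App c a => App c [ffun i => subst s (a i)]
  end.

Fixpoint var phi : set V :=
  match phi with
  | Var x => [set x]
  | App c a => \bigcup_i var (a i)
  end.

Definition vars G : set V := \bigcup_(g in G) var g.

Record logic := Logic {
  entails : set (Fm L V) -> Fm L V -> Prop;
  entails_refl : forall G phi, G phi -> entails G phi;
  entails_trans : forall D S phi,
    (forall psi, S psi -> entails D psi) -> entails S phi -> entails D phi;
  entails_subst : forall (s : V -> Fm L V) G phi,
    entails G phi -> entails (subst s @` G) (subst s phi)
}.

Definition left_entails (S : logic) G phi : Prop :=
  exists G', [/\ G' `<=` G, vars G' `<=` var phi & entails S G' phi].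

Definition ECQ (neg : unary L) (S : logic) : Prop :=
  forall alpha beta, entails S [set alpha; App1 neg alpha] beta.

Fixpoint var_subst (s : V -> Fm L V) phi :
  var (subst s phi) = \bigcup_(x in var phi) var (s x).
Proof.
case: phi => [x|c a] /=; first by rewrite bigcup_set1.
apply/seteqP; split=> [y [i _]|y [x [i _ xi] yx]].
  by rewrite ffunE var_subst => -[x xi yx]; exists x => //; exists i.
by exists i => //; rewrite ffunE var_subst; exists x.
Qed.

Lemma left_entails_refl S G phi : G phi -> left_entails S G phi.
Proof.
move=> Gphi; exists [set phi]; split; first by move=> _ ->.
- by rewrite /vars bigcup_set1.
- exact: entails_refl.
Qed.

Lemma left_entails_trans S D T phi :
  (forall psi, T psi -> left_entails S D psi) ->
  left_entails S T phi -> left_entails S D phi.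
Proof.
move=> DT [T' [T'T vT' T'phi]].
exists [set d | D d /\ var d `<=` var phi]; split; first by move=> d [].
  by move=> x [d [_ dphi] /dphi].
apply: entails_trans T'phi => psi T'psi.
have [D' [D'D vD' D'psi]] := DT _ (T'T _ T'psi).
apply: entails_trans D'psi => d D'd; apply: entails_refl; split.
  exact: D'D.
move=> x dx; apply: vT'; exists psi => //.
by apply: vD'; exists d.
Qed.

Lemma left_entails_subst S (s : V -> Fm L V) G phi :
  left_entails S G phi -> left_entails S (subst s @` G) (subst s phi).
Proof.
move=> [G' [G'G vG' G'phi]]; exists (subst s @` G'); split.
- exact: image_subset.
- move=> y [_ [g G'g <-]]; rewrite !var_subst => -[x gx yx].
  by exists x => //; apply: vG'; exists g.
- exact: entails_subst.
Qed.

Definition left_companion (S : logic) : logic :=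
  Logic (@left_entails_refl S) (@left_entails_trans S) (@left_entails_subst S).

End Formulas.

(* Main.v *)
Require Import Defs.
From mathcomp Require Import all_boot.
From mathcomp Require Import boolp classical_sets functions cardinality.
Local Open Scope classical_set_scope.
Local Open Scope card_scope.

(** The companion may use only premises whose variables all occur in [alpha]. Since [p] occurs in
    [Var p] and, by [var_App1], in its negation, but not in [alpha], no premise is usable, and
    [set0] does not entail [alpha]. This single instance refutes ECQ. *)

Lemma var_App1 (L : language) (V : Type) (c : unary L) (phi : Fm L V) :
  var (App1 c phi) = var phi.
Proof.
apply/seteqP; split=> [x [i _]|x phix] /=; first by rewrite ffunE.
(* The union over argument positions needs an inhabited index type to contain [var phi]; position 0
   serves. *)
have ac : (0 < arity c)%N by rewrite unary_arity.
by exists (Ordinal ac) => //; rewrite ffunE.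
Qed.

Theorem theorem3p9 (L : language) (neg : unary L)
    (V : Type) (hV : [set: V] #= [set: nat])
    (S : logic L V) (alpha : Fm L V) (p : V)
    (halpha : ~ entails S set0 alpha) (hp : ~ var alpha p) :
  ~ ECQ neg (left_companion S) /\
  ~ entails (left_companion S) [set Var p; App1 neg (Var p)] alpha.
Proof.
suff nent : ~ entails (left_companion S) [set Var p; App1 neg (Var p)] alpha.
  by split=> // ecq; apply/nent/ecq.
(* Both premises contain [p], which [alpha] does not, so only the empty set of
   premises is available to the companion. *)
move=> [G [Gsub Gvar Galpha]]; apply: halpha; suff <- : G = set0 by [].
rewrite -subset0 => g Gg; apply: hp; apply: Gvar; exists g => //.
by case: (Gsub g Gg) => ->; rewrite ?var_App1.
Qed.
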